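(* Let $\pi$ be a permutation of $\mathbb{F}_2^m$. If $\pi$ satisfies the property $(P_2)$ with respect to every linear subspace $S$ of $\mathbb{F}_2^m$ with $1\le \dim(S)\le m-1$ and $\dim(S)\le m-\deg(\pi)+1$ such that $D_aD_b\pi=0_m$ for all $a,b\in S$, then $\pi$ satisfies the property $(P_2)$. In particular, if $\deg(\pi)=m-1$, and $\pi$ has no linear structures and satisfies $(P_2)$ with respect to every $2$-dimensional subspace $S$ (with $\dim(S)\le m-1$) such that $D_aD_b\pi=0_m$ for all $a,b\in S$, then $\pi$ satisfies the property $(P_2)$.
   Context: For $F\colon\mathbb{F}_2^m\to\mathbb{F}_2^m$ and $a,b\in\mathbb{F}_2^m$: $D_aF(y)=F(y+a)+F(y)$ and $D_aD_bF(y)=F(y+a+b)+F(y+a)+F(y+b)+F(y)$. $0_m$ denotes the zero vector; $D_aD_bF=0_m$ means the function is identically $0_m$. $v\cdot w=\sum_i v_iw_i$ is the standard scalar product over $\mathbb{F}_2$. $\deg(F)$ is the maximum of the algebraic degrees (degrees of the algebraic normal forms, i.e. multilinear polynomials over $\mathbb{F}_2$) of the coordinate functions of $F$. A vector $a$ is a linear structure of $F$ if $D_aF$ is a constant function; $F$ has no linear structures if $0_m$ is its only linear structure. Property $(P_2)$ with respect to $S$: let $S$ be a subspace of $\mathbb{F}_2^m$ with $1\le\dim(S)\le m-1$ such that $D_aD_b\pi=0_m$ for all $a,b\in S$. Then $\pi$ satisfies $(P_2)$ with respect to $S$ if there does not exist a linear subspace $V$ of $\mathbb{F}_2^m$ with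 $\dim(V)=m-\dim(S)$ such that $v\cdot D_a\pi(y)=0$ for all $a\in S$, all $y\in\mathbb{F}_2^m$ and all $v\in V$. If $\pi$ satisfies $(P_2)$ with respect to every subspace $S$ with $1\le\dim(S)\le m-1$ such that $D_aD_b\pi=0_m$ for all $a,b\in S$, then $\pi$ is said to satisfy $(P_2)$. *)

(* Defs.v *)
From mathcomp Require Import all_boot all_order all_algebra all_fingroup.

Set Implicit Arguments.
Unset Strict Implicit.
Unset Printing Implicit Defensive.

Import GRing.Theory.
Local Open Scope ring_scope.

Section VectorialBooleanFunctions.

Variable m : nat.

Implicit Types (F : 'rV['F_2]_m -> 'rV['F_2]_m) (f : 'rV['F_2]_m -> 'F_2).
Implicit Types (S V : {vspace 'rV['F_2]_m}).

Definition dotp (v w : 'rV['F_2]_m) : 'F_2 := \sum_(i < m) v 0 i * w 0 i.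

Definition deriv1 F (a y : 'rV['F_2]_m) : 'rV['F_2]_m := F (y + a) + F y.

Definition deriv2 F (a b y : 'rV['F_2]_m) : 'rV['F_2]_m :=
  F (y + a + b) + F (y + a) + F (y + b) + F y.

(* A multilinear polynomial in x_0, ..., x_(m-1) over F_2 is given by its     *)
(* coefficients: c I is the coefficient of the monomial \prod_(i in I) x_i.   *)
Notation multilin := {ffun {set 'I_m} -> 'F_2}.

Definition multilin_eval (c : multilin) (x : 'rV['F_2]_m) : 'F_2 :=
  \sum_(I : {set 'I_m}) c I * \prod_(i in I) x 0 i.

Definition multilin_deg (c : multilin) : nat :=
  \max_(I : {set 'I_m} | c I != 0) #|I|.

(* The default value is never used, by anfP; anf_uniq shows that the choice   *)
(* is forced.                                                                 *)
Definition anf f : multilin :=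
  odflt [ffun=> 0] [pick c : multilin | [forall x, multilin_eval c x == f x]].

Lemma multilin_eval_inj (c d : multilin) :
  multilin_eval c =1 multilin_eval d -> c = d.
Proof.
move=> ecd; apply/ffunP => I.
have [n] := ubnP #|I|; elim: n I => // n IHn I ltIn.
pose x : 'rV['F_2]_m := \row_i (i \in I)%:R.
have evx (e : multilin) :
    multilin_eval e x = e I + \sum_(J : {set 'I_m} | J \proper I) e J.
  rewrite /multilin_eval (bigD1 I) //= big1 ?mulr1; last first.
    by move=> i iI; rewrite mxE iI.
  congr (_ + _); rewrite [RHS]big_mkcond [LHS]big_mkcond /=.
  apply: eq_bigr => J _; rewrite properEneq.
  case: eqVneq => //= _; case: (boolP (J \subset I)) => [sJI | /subsetPn[i iJ iI]].
    by rewrite big1 ?mulr1 // => i iJ; rewrite mxE (subsetP sJI).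
  by rewrite (bigD1 i) //= mxE (negbTE iI) mul0r mulr0.
have := ecd x; rewrite !evx (eq_bigr (fun J => d J)) => [|J pJI].
  exact: addIr.
by apply: IHn; apply: leq_trans (proper_card pJI) _.
Qed.

Lemma multilin_eval_surj f : exists c : multilin, multilin_eval c =1 f.
Proof.
pose ev (c : multilin) : {ffun 'rV['F_2]_m -> 'F_2} :=
  [ffun x => multilin_eval c x].
have ev_inj : injective ev.
  move=> c d /ffunP ecd; apply: multilin_eval_inj => x.
  by have := ecd x; rewrite !ffunE.
have [|g _ gK] := inj_card_bij ev_inj.
  by rewrite !card_ffun card_mx mul1n card_Fp // -cardsT -powersetT
     card_powerset cardsT card_ord.
by exists (g (finfun f)) => x; have /ffunP/(_ x) := gK (finfun f); rewrite !ffunE.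
Qed.

Lemma anfP f : multilin_eval (anf f) =1 f.
Proof.
rewrite /anf; case: pickP => [c /forallP ec x | no_c]; first exact/eqP.
have [c ec] := multilin_eval_surj f.
by have /forallP[] := negbT (no_c c); move=> x; rewrite ec.
Qed.

Lemma anf_uniq f (c : multilin) : multilin_eval c =1 f -> c = anf f.
Proof. by move=> ec; apply: multilin_eval_inj => x; rewrite ec anfP. Qed.

Definition alg_deg F : nat :=
  \max_(i < m) multilin_deg (anf (fun x => F x 0%R i)).

(* Hence m - alg_deg F is never a truncated subtraction.                      *)
Lemma alg_deg_le F : (alg_deg F <= m)%N.
Proof.
apply/bigmax_leqP => i _; apply/bigmax_leqP => I _.
by rewrite -[leqRHS]card_ord max_card.
Qed.

Definition linear_structure F (a : 'rV['F_2]_m) : Prop :=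
  exists c, forall y, deriv1 F a y = c.

Definition no_linear_structures F : Prop :=
  forall a, linear_structure F a -> a = 0.

Definition deriv2_vanishes_on F S : Prop :=
  forall a b, a \in S -> b \in S -> forall y, deriv2 F a b y = 0.

(* P2_wrt is only meaningful for the subspaces S quantified over in P2.       *)
Definition P2_wrt F S : Prop :=
  ~ exists V, \dim V = (m - \dim S)%N /\
      forall a y v, a \in S -> v \in V -> dotp v (deriv1 F a y) = 0.

Definition P2 F : Prop :=
  forall S, (1 <= \dim S <= m - 1)%N -> deriv2_vanishes_on F S -> P2_wrt F S.

End VectorialBooleanFunctions.

(* Main.v *)
Require Import Defs.
From mathcomp Require Import all_boot all_order all_algebra all_fingroup.
From mathcomp Require Import zify.

Set Implicit Arguments.
Unset Strict Implicit.
Unset Printing Implicit Defensive.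

Import GRing.Theory.
Local Open Scope ring_scope.

(** The first implication holds because its bound on dim(S) is automatic: if
    D_a D_b F vanishes for all a, b in S then deg(F) + dim(S) <= m + 1
    (lemma alg_deg_dim_le). Indeed the coefficient of a monomial x^I in the
    algebraic normal form of f is the sum of f over the space E_I of vectors
    supported in I (anf_coef). If |I| + dim(S) >= m + 2, then the intersection
    of E_I and S has dimension at least 2, hence contains two linearly
    independent vectors a and b; the sum over E_I splits into sums over the
    cosets of <a, b>, and each of these is a value of D_a D_b f, that is 0.

    When deg(F) = m - 1 the bound leaves only the dimensions 1 and 2. For a line
    S = {0, a}, a failure of (P_2) says that D_a F takes all its values in the
    orthogonal of a hyperplane V. That orthogonal has a single nonzero element
    (orthogonal_hyperplane_uniq), and D_a F never vanishes because F is
    injective; so D_a F is constant and a is a nonzero linear structure. *)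

(** * Arithmetic in characteristic 2 *)

Lemma F2_eq0_or_1 (x : 'F_2) : x = 0 \/ x = 1.
Proof. by case: x => [[|[|//]] ?]; [left | right]; apply/val_inj. Qed.

Lemma addF2_self (x : 'F_2) : x + x = 0.
Proof. by case: (F2_eq0_or_1 x) => ->; apply/val_inj. Qed.

Lemma addrv_self m (y : 'rV['F_2]_m) : y + y = 0.
Proof. by apply/rowP => i; rewrite !mxE addF2_self. Qed.

Lemma addrvK m (a y : 'rV['F_2]_m) : y + a + a = y.
Proof. by rewrite -addrA addrv_self addr0. Qed.

Lemma rV_neq0P (m : nat) (a : 'rV['F_2]_m) : a != 0 -> exists i, a 0 i = 1.
Proof.
move=> /eqP a0; case: (pickP (fun i => a 0 i != 0)) => [i ai | a_eq0].
  by exists i; case: (F2_eq0_or_1 (a 0 i)) => // ai0; rewrite ai0 eqxx in ai.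
by case: a0; apply/rowP => i; rewrite mxE; apply/eqP/negPn; rewrite a_eq0.
Qed.

(** * Coefficients of the algebraic normal form *)

(** When a has i-th coordinate 1, each coset of the line spanned by a contains
    exactly one vector with i-th coordinate 0. Applied to a and then to b, this
    turns a sum of f into a sum of second derivatives of f. *)
Lemma sum_pair_translate (m : nat) (G : 'rV['F_2]_m -> 'F_2)
    (P : pred 'rV['F_2]_m) (a : 'rV['F_2]_m) (i : 'I_m) :
    a 0 i = 1 -> (forall y, P (y + a) = P y) ->
  \sum_(y | P y) G y = \sum_(y | P y && (y 0 i == 0)) (G y + G (y + a)).
Proof.
move=> ai Pa; rewrite (bigID (fun y : 'rV_m => y 0 i == 0)) /= big_split /=.
congr (_ + _).
rewrite (reindex_inj (addIr a)) /=; apply: eq_bigl => y.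
rewrite Pa mxE ai; congr (_ && _).
by case: (F2_eq0_or_1 (y 0 i)) => ->.
Qed.

Definition supported_in (m : nat) (I : {set 'I_m}) (y : 'rV['F_2]_m) : bool :=
  [forall j in ~: I, y 0 j == 0].

Lemma supported_inD (m : nat) (I : {set 'I_m}) (a y : 'rV['F_2]_m) :
  supported_in I a -> supported_in I (y + a) = supported_in I y.
Proof.
move=> /'forall_implyP Ia; apply: eq_forallb_in => j jI.
by rewrite mxE (eqP (Ia j jI)) addr0.
Qed.

(** On the vectors supported in I, the monomial x^I is 1 only at the indicator of
    I. A monomial x^J with J not inside I is 0 there; for J strictly inside I,
    adding the i-th unit vector for some i in I outside J leaves x^J unchanged,
    so the terms cancel in pairs. *)
Lemma sum_monomial_supported (m : nat) (I J : {set 'I_m}) :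
  \sum_(y | supported_in I y) \prod_(j in J) y 0 j = (J == I)%:R :> 'F_2.
Proof.
case: eqVneq => [->|neJI].
  rewrite (bigD1 (\row_i (i \in I)%:R)) /=; last first.
    by apply/'forall_implyP => j; rewrite inE mxE => /negbTE ->.
  rewrite big1 => [|i iI]; last by rewrite mxE iI.
  rewrite big1 ?addr0 // => y /andP[/'forall_implyP Iy y_neq].
  have [i iI yi0] : exists2 i, i \in I & y 0 i = 0.
    case: (pickP [pred i in I | y 0 i == 0]) => [i /andP[iI /eqP] | y_neq0].
      by exists i.
    case/eqP: y_neq; apply/rowP => j; rewrite mxE.
    case: (boolP (j \in I)) => jI; last by apply/eqP/Iy; rewrite inE.
    by case: (F2_eq0_or_1 (y 0 j)) => // yj0; have := y_neq0 j; rewrite /= jI yj0 eqxx.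
  by rewrite (bigD1 i) //= yi0 mul0r.
case: (boolP (J \subset I)) => [sJI | /subsetPn[j jJ jI]]; last first.
  apply: big1 => y /'forall_implyP Iy; rewrite (bigD1 j) //= (eqP (Iy j _)) ?mul0r //.
  by rewrite inE.
have /subsetPn[i iI iJ] : ~~ (I \subset J).
  by apply: contra neJI => sIJ; rewrite eqEsubset sJI.
rewrite (@sum_pair_translate _ _ _ (delta_mx 0 i) i).
- apply: big1 => y _; rewrite [X in _ + X](eq_bigr (fun j => y 0 j)) ?addF2_self //.
  by move=> j jJ; rewrite !mxE (_ : j == i = false) ?andbF ?addr0 //;
     apply: contraNF iJ => /eqP <-.
- by rewrite mxE !eqxx.
move=> y; apply: supported_inD; apply/'forall_implyP => j; rewrite inE => jI.
by rewrite mxE (_ : j == i = false) ?andbF //; apply: contraNF jI => /eqP ->.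
Qed.

(** Moebius inversion on the subsets of I, where all signs are 1. *)
Lemma anf_coef (m : nat) (f : 'rV['F_2]_m -> 'F_2) (I : {set 'I_m}) :
  anf f I = \sum_(y | supported_in I y) f y.
Proof.
under eq_bigr => y _ do rewrite -(anfP f) /multilin_eval.
rewrite exchange_big (bigD1 I) //= -big_distrr /= sum_monomial_supported eqxx.
rewrite mulr1 big1 ?addr0 // => J neJI.
by rewrite -big_distrr /= sum_monomial_supported (negbTE neJI) mulr0.
Qed.

(** * The degree bound *)

Lemma dim_rV (K : fieldType) (n : nat) : \dim {:'rV[K]_n} = n.
Proof. by rewrite dimvf /dim /= mul1n. Qed.

Lemma vspace_vanishing_coords (K : fieldType) (m : nat)
    (S : {vspace 'rV[K]_m}) (J : {set 'I_m}) :
    (#|J| < \dim S)%N ->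
  exists a, [/\ a \in S, a != 0 & forall j, j \in J -> a 0 j = 0].
Proof.
move=> ltJS.
pose M : 'M[K]_(m, #|J|) := \matrix_(i, k) (i == enum_val k)%:R.
pose f := linfun (mulmxr M : 'rV[K]_m -> 'rV[K]_#|J|).
have W_neq0 : (S :&: lker f)%VS != 0%VS.
  have lefJ := dimvS (subvf (f @: S)); rewrite dim_rV in lefJ.
  rewrite -dimv_eq0 -lt0n -(ltn_add2r (\dim (f @: S))) limg_ker_dim.
  exact: leq_ltn_trans lefJ ltJS.
exists (vpick (S :&: lker f)); split; last 1 first.
- move=> j jJ; have := memv_pick (S :&: lker f)%VS.
  rewrite memv_cap memv_ker lfunE /= => /andP[_ /eqP/rowP/(_ (enum_rank_in jJ j))].
  rewrite !mxE (bigD1 j) //= mxE enum_rankK_in // eqxx mulr1 big1 ?addr0 //.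
  by move=> i ij; rewrite mxE enum_rankK_in // (negbTE ij) mulr0.
- exact: (subvP (capvSl _ _) _ (memv_pick _)).
- by rewrite vpick0.
Qed.

(** Choosing b with a zero at a coordinate i where a is 1 makes a and b linearly
    independent, and lets the vectors of E_I with y_i = 0 be paired off along b
    after the pairing along a. *)
Lemma anf_coef_deriv2_eq0 (m : nat) (F : 'rV['F_2]_m -> 'rV['F_2]_m)
    (S : {vspace 'rV['F_2]_m}) (k : 'I_m) (I : {set 'I_m}) :
    deriv2_vanishes_on F S -> (m + 1 < #|I| + \dim S)%N ->
  anf (fun x => F x 0 k) I = 0.
Proof.
move=> FS ltm; have cI := cardsC I; rewrite card_ord in cI.
have [|a [aS a0 aI]] := @vspace_vanishing_coords _ _ S (~: I).
  by rewrite -(ltn_add2l #|I|) cI; apply: leq_trans ltm; rewrite addn1.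
have [i ai] := rV_neq0P a0.
have [|b [bS b0 bI]] := @vspace_vanishing_coords _ _ S (i |: ~: I).
  rewrite -(ltn_add2l #|I|); apply: leq_ltn_trans ltm.
  by rewrite cardsU1 addnCA cI addnC leq_add2l leq_b1.
have [j bj] := rV_neq0P b0.
rewrite anf_coef (@sum_pair_translate _ _ _ a i) //; last first.
  by move=> y; apply: supported_inD; apply/'forall_implyP => l /aI ->.
rewrite (@sum_pair_translate _ _ _ b j) //; last first.
  move=> y; rewrite mxE (bI i) ?addr0 ?setU11 //; congr (_ && _).
  by apply: supported_inD; apply/'forall_implyP => l lI; rewrite bI ?setU1r.
apply: big1 => y _; have /rowP/(_ k) := FS _ _ bS aS y.
rewrite /deriv2 !mxE => <-.
by rewrite [LHS]addrC (addrC (F (y + b) 0 k)) (addrC (F y 0 k)) [LHS]addrA.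
Qed.

Lemma alg_deg_dim_le (m : nat) (F : 'rV['F_2]_m -> 'rV['F_2]_m)
    (S : {vspace 'rV['F_2]_m}) :
  deriv2_vanishes_on F S -> (alg_deg F + \dim S <= m + 1)%N.
Proof.
move=> FS; have dS := dimvS (subvf S); rewrite dim_rV in dS.
suff: (alg_deg F <= m + 1 - \dim S)%N by lia.
apply/bigmax_leqP => k _; apply/bigmax_leqP => I.
apply: contraNT; rewrite -ltnNge => ltI.
by rewrite (anf_coef_deriv2_eq0 _ FS) //; lia.
Qed.

(** * Lines *)

Lemma dotp_delta (m : nat) (i : 'I_m) (u : 'rV['F_2]_m) :
  dotp (delta_mx 0 i) u = u 0 i.
Proof.
rewrite /dotp (bigD1 i) //= mxE !eqxx mul1r big1 ?addr0 // => j ji.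
by rewrite mxE (negbTE ji) andbF mul0r.
Qed.

Lemma dotpE (m : nat) (v u : 'rV['F_2]_m) : dotp v u = (v *m u^T) 0 0.
Proof. by rewrite mxE; apply: eq_bigr => i _; rewrite mxE. Qed.

(** A nonzero u orthogonal to the hyperplane V has exactly V as kernel of its
    scalar product, and over F_2 a linear form is determined by its kernel. *)
Lemma orthogonal_hyperplane_uniq (m : nat) (V : {vspace 'rV['F_2]_m})
    (u w : 'rV['F_2]_m) :
    \dim V = (m - 1)%N -> u != 0 -> w != 0 ->
    (forall v, v \in V -> dotp v u = 0) ->
    (forall v, v \in V -> dotp v w = 0) ->
  u = w.
Proof.
move=> dV u0 w0 Vu Vw.
have memV (t : 'rV['F_2]_m) : t != 0 -> (forall v, v \in V -> dotp v t = 0) ->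
    forall v, (v \in V) = (dotp v t == 0).
  move=> t0 Vt v.
  pose f := linfun (mulmxr t^T : 'rV['F_2]_m -> 'rV['F_2]_1).
  have kerE x : (x \in lker f) = (dotp x t == 0).
    rewrite memv_ker lfunE /= dotpE; apply/eqP/eqP => [-> | x0].
      by rewrite mxE.
    by apply/rowP => i; rewrite ord1 x0 mxE.
  rewrite -kerE; suff -> : V = lker f by [].
  apply/eqP; rewrite eqEdim dV; apply/andP; split.
    by apply/subvP => x xV; rewrite kerE Vt.
  have [i ti] := rV_neq0P t0.
  have : lker f != fullv.
    apply/eqP => kf; have := memvf (delta_mx 0 i : 'rV['F_2]_m).
    by rewrite -kf kerE dotp_delta ti.
  rewrite eqEdim subvf /= -ltnNge dim_rV subn1 => lt_dim_m.
  by rewrite -ltnS (ltn_predK lt_dim_m).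
apply/rowP => i; rewrite -!dotp_delta; set v := delta_mx 0 i.
have := memV _ u0 Vu v; rewrite (memV _ w0 Vw).
by case: (F2_eq0_or_1 (dotp v u)) => ->; case: (F2_eq0_or_1 (dotp v w)) => ->.
Qed.

(** Injectivity is what makes D_a F nonvanishing: its values are then all equal to
    the one nonzero vector orthogonal to V. *)
Lemma P2_wrt_line (m : nat) (F : 'rV['F_2]_m -> 'rV['F_2]_m)
    (S : {vspace 'rV['F_2]_m}) :
  injective F -> no_linear_structures F -> \dim S = 1%N -> P2_wrt F S.
Proof.
move=> injF nlF dS [V [dV VS]].
have aS := memv_pick S; set a := vpick S in aS.
have a0 : a != 0 by rewrite vpick0 -dimv_eq0 dS.
have Da0 y : deriv1 F a y != 0.
  apply: contra a0 => /eqP Dy.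
  have /injF/eqP : F (y + a) = F y.
    by rewrite -[RHS]add0r -Dy /deriv1 addrvK.
  by rewrite -subr_eq0 addrAC subrr add0r.
case/negP: a0; apply/eqP/nlF; exists (deriv1 F a 0) => y.
rewrite dS in dV; apply: (orthogonal_hyperplane_uniq dV) => // v vV; exact: VS.
Qed.

Theorem theorem3p8 (m : nat) (pi : {perm 'rV['F_2]_m}) :
  ((forall S : {vspace 'rV['F_2]_m},
      (1 <= \dim S <= m - 1)%N ->
      (\dim S <= m - alg_deg pi + 1)%N ->
      deriv2_vanishes_on pi S ->
      P2_wrt pi S) ->
   P2 pi)
  /\
  (alg_deg pi = (m - 1)%N ->
   no_linear_structures pi ->
   (forall S : {vspace 'rV['F_2]_m},
      \dim S = 2%N ->
      (\dim S <= m - 1)%N ->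
      deriv2_vanishes_on pi S ->
      P2_wrt pi S) ->
   P2 pi).
Proof.
split=> [P2pi | deg_pi nl_pi P2pi] S dS piS; have := alg_deg_dim_le piS.
  have := alg_deg_le pi => le_deg le_dim; apply: P2pi => //; lia.
rewrite deg_pi => le_dim.
have [dS1 | dS2] : \dim S = 1%N \/ \dim S = 2%N by lia.
  exact: P2_wrt_line (@perm_inj _ pi) nl_pi dS1.
by apply: P2pi => //; lia.
Qed.
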